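(* Let $R$ be a ring. For any right ideal $P\subsetneq R$, the following are equivalent: (1) $P\in\operatorname{Max}(\mathcal{F}')$ for some right Gabriel filter $\mathcal{F}$ in $R$; (2) $P\in\operatorname{Max}(\mathcal{F}_P')$, where $\mathcal{F}_P$ is the set of all right ideals $J$ of $R$ such that $\operatorname{Hom}_R(R/J,E(R/P))=0$; (3) $P$ is a comonoform right ideal.
   Context: Rings are associative with $1$, modules are unital. For a family $\mathcal{F}$ of right ideals of $R$, $\mathcal{F}'$ denotes the set of right ideals of $R$ not in $\mathcal{F}$, and $\operatorname{Max}(\mathcal{F}')$ the set of its elements maximal with respect to inclusion. $E(M)$ denotes the injective hull of a right module $M$. For an element $m$ and a submodule $N$ of a right $R$-module $M$, put $m^{-1}N:=\{r\in R: mr\in N\}$; in particular $a^{-1}I=\{r\in R: ar\in I\}$ for a right ideal $I$ and $a\in R$. A right Gabriel filter in $R$ is a nonempty family $\mathcal{F}$ of right ideals of $R$ such that, for right ideals $I,J$ of $R$: (i) if $I\in\mathcal{F}$ and $J\supseteq I$ then $J\in\mathcal{F}$; (ii) if $I,J\in\mathcal{F}$ then $I\cap J\in\mathcal{F}$; (iii) if $I\in\mathcal{F}$ and $x\in R$ then $x^{-1}I\in\mathcal{F}$; (iv) if $I\in\mathcal{F}$ and $J$ is such that $x^{-1}J\in\mathcal{F}$ for all $x\in I$, then $J\in\mathcal{F}$. The family $\mathcal{F}_P$ is a right Gabriel filter (the one cogenerated by the injective module $E(R/P)$). A submodule $N\subseteq M$ is dense in $M$ if for all $x,y\in M$ with $x\neq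 0$, $x\cdot(y^{-1}N)\neq 0$. A nonzero right module $M$ is monoform if every nonzero submodule of $M$ is dense in $M$ (equivalently, for every submodule $C\subseteq M$, every nonzero homomorphism $C\to M$ is injective). A right ideal $P\subsetneq R$ is comonoform if the right module $R/P$ is monoform. *)

(* Defs.v *)
From HB Require Import structures.
From mathcomp Require Import all_boot all_order all_algebra.
From mathcomp Require Import boolp classical_sets functions.

Set Implicit Arguments.
Unset Strict Implicit.
Unset Printing Implicit Defensive.

Import Order.TTheory GRing.Theory Num.Theory.
Local Open Scope ring_scope.
Local Open Scope classical_set_scope.
Local Open Scope quotient_scope.

(* A submodule of V is a predicate of the library type [submodClosed V].  A
   right R-module is an [lmodType R^c], so that [r *: x] with [r : R^c] is the
   product x r; in the regular right module [(R^c)^o] of R, [r *: x = x * r],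
   so that its submodules are the right ideals of R. *)
Notation rmodType R := (lmodType R^c).
Notation right_ideal R := (submodClosed R^c^o).

Section Submodules.
Variables (S : pzRingType) (V : lmodType S).

Section Intersection.
Variables N1 N2 : submodClosed V.

Definition capS_pred : {pred V} := [predI N1 & N2].

Lemma capS_closed : submod_closed capS_pred.
Proof.
split=> [|a x y /andP[/= x1 x2] /andP[/= y1 y2]].
  by apply/andP; split=> /=; apply: rpred0.
by apply/andP; split=> /=; apply: rpredD => //; apply: rpredZ.
Qed.

HB.instance Definition _ := GRing.isSubmodClosed.Build S V capS_pred capS_closed.

Definition capS : submodClosed V := capS_pred.
End Intersection.

Section Residual.
Variables (m : V) (N : submodClosed V).

Definition residual_pred : {pred S^o} := [pred r : S^o | (r : S) *: m \in N].

Lemma residual_closed : submod_closed residual_pred.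
Proof.
split=> [|a r s]; rewrite !inE ?scale0r ?rpred0 //.
move=> rm sm; rewrite scalerDl -scalerA.
by apply: rpredD => //; apply: rpredZ.
Qed.

HB.instance Definition _ :=
  GRing.isSubmodClosed.Build S S^o residual_pred residual_closed.

(* For S := R^c this is the right ideal m^-1 N of R. *)
Definition residual : submodClosed S^o := residual_pred.
End Residual.

Section Quotient.
Variable N : submodClosed V.

Definition submod_pred : {pred V} := N.

Lemma submod_pred_zmod_closed : zmod_closed submod_pred.
Proof. exact/GRing.submod_closedB/submodClosedP. Qed.

HB.instance Definition _ :=
  GRing.isZmodClosed.Build V submod_pred submod_pred_zmod_closed.

Definition quotmod : Type := Quotient.quot submod_pred.

HB.instance Definition _ := GRing.Zmodule.on quotmod.
HB.instance Definition _ := EqQuotient.on quotmod.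

Definition quotmod_pi (x : V) : quotmod := \pi_(Quotient.quot submod_pred) x.

Definition quotmod_scale (a : S) (x : quotmod) : quotmod :=
  quotmod_pi (a *: repr x).

Lemma quotmod_piP x y : (quotmod_pi x == quotmod_pi y) = (x - y \in N).
Proof.
exact/esym/(Quotient.idealrBE submod_pred x y).
Qed.

Lemma quotmod_piD x y : quotmod_pi (x + y) = quotmod_pi x + quotmod_pi y.
Proof. by rewrite /quotmod_pi raddfD. Qed.

Lemma quotmod_reprK x : quotmod_pi (repr x) = x.
Proof. exact: reprK. Qed.

Lemma quotmod_piZ a x : quotmod_pi (a *: x) = quotmod_scale a (quotmod_pi x).
Proof.
apply/eqP; rewrite quotmod_piP -scalerBr; apply: rpredZ.
by rewrite -quotmod_piP quotmod_reprK.
Qed.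

Lemma quotmod_scaleA a b x :
  quotmod_scale a (quotmod_scale b x) = quotmod_scale (a * b) x.
Proof. by rewrite -[x]quotmod_reprK -!quotmod_piZ scalerA. Qed.

Lemma quotmod_scale1 : left_id 1 quotmod_scale.
Proof. by move=> x; rewrite -[x]quotmod_reprK -quotmod_piZ scale1r. Qed.

Lemma quotmod_scaleDr : right_distributive quotmod_scale +%R.
Proof.
move=> a x y; rewrite -[x]quotmod_reprK -[y]quotmod_reprK.
by rewrite -quotmod_piD -!quotmod_piZ scalerDr quotmod_piD.
Qed.

Lemma quotmod_scaleDl x : {morph quotmod_scale^~ x : a b / a + b}.
Proof.
move=> a b; rewrite -[x]quotmod_reprK -!quotmod_piZ scalerDl.
exact: quotmod_piD.
Qed.

HB.instance Definition _ := GRing.Zmodule_isLmodule.Build S quotmod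
  quotmod_scaleA quotmod_scale1 quotmod_scaleDr quotmod_scaleDl.

Lemma quotmod_pi_linear : linear quotmod_pi.
Proof. by move=> a x y; rewrite quotmod_piD quotmod_piZ. Qed.

HB.instance Definition _ :=
  GRing.isLinear.Build S V quotmod _ quotmod_pi quotmod_pi_linear.
End Quotient.
End Submodules.

Section InjectiveHull.
Variable S : pzRingType.

Definition injective_module (E : lmodType S) : Prop :=
  forall (A B : lmodType S) (i : {linear A -> B}) (f : {linear A -> E}),
    injective i -> exists g : {linear B -> E}, forall a, g (i a) = f a.

Definition nonzero_submod (V : lmodType S) (N : submodClosed V) : Prop :=
  exists2 x, x \in N & x != 0.

Definition essential (M E : lmodType S) (i : {linear M -> E}) : Prop :=
  forall N : submodClosed E,
    nonzero_submod N -> exists2 m, i m \in N & i m != 0.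

Definition is_injective_hull (M E : lmodType S) (i : {linear M -> E}) : Prop :=
  [/\ injective i, essential i & injective_module E].
End InjectiveHull.

(* Existence of injective hulls: M embeds in the injective module coinduced
   from a power of Q/Z, inside which a maximal essential extension of M is a
   direct summand. *)

Lemma Zorn_above (T : Type) (Q : set (set T)) (X0 : set T) :
    Q X0 ->
    (forall F, F !=set0 -> F `<=` Q -> total_on F subset ->
      Q (\bigcup_(X in F) X)) ->
  exists A, [/\ Q A, X0 `<=` A & forall B, Q B -> A `<=` B -> B `<=` A].
Proof.
move=> QX0 Qcup.
have [|A [QA maxA]] := @Zorn_bigcup T [set X | Q (X0 `|` X)].
  move=> F FQ totF; have [->|F0] := eqVneq F set0.
    by rewrite /= bigcup_set0 setU0.
  have {F0} : F !=set0 by apply/set0P.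
  move=> [Y FY]; rewrite /=.
  have -> : X0 `|` \bigcup_(X in F) X =
            \bigcup_(Z in [set X0 `|` X | X in F]) Z.
    apply/seteqP; split=> [x [X0x|[X FX Xx]]|x [_ [X FX <-] [X0x|Xx]]].
    - by exists (X0 `|` Y); [exists Y|left].
    - by exists (X0 `|` X); [exists X|right].
    - by left.
    - by right; exists X.
  apply: Qcup => [|_ [X /FQ QX <-] //|_ _ [X FX <-] [X' FX' <-]].
    by exists (X0 `|` Y), Y.
  by have [XX'|X'X] := totF _ _ FX FX'; [left|right]; apply: setUS.
exists (X0 `|` A); split=> [//|x|B QB AB]; first by left.
have X0B : X0 `|` B = B by apply/setUidPr => x ?; apply: AB; left.
apply: contrapT => nBA; apply: (maxA B); last by rewrite /= X0B.
split=> [x Ax|sBA]; first by apply: AB; right.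
by apply: nBA => x /sBA; right.
Qed.

Lemma total_on_pair (T : Type) (F : set (set T)) x y :
    total_on F subset -> (\bigcup_(X in F) X) x -> (\bigcup_(X in F) X) y ->
  exists X, [/\ F X, X x & X y].
Proof.
move=> totF [X FX Xx] [Y FY Yy]; have [XY|YX] := totF _ _ FX FY.
  by exists Y; split=> //; apply: XY.
by exists X; split=> //; apply: YX.
Qed.

Definition rat_int_pred : {pred rat} := [pred q | q \is a Num.int].

Lemma rat_int_pred_zmod_closed : zmod_closed rat_int_pred.
Proof. by split=> [|x y]; rewrite !inE ?rpred0 //; apply: rpredB. Qed.

HB.instance Definition _ :=
  GRing.isZmodClosed.Build rat rat_int_pred rat_int_pred_zmod_closed.

Definition rat_mod_int : zmodType := Quotient.quot rat_int_pred.

Definition rmi_pi (q : rat) : rat_mod_int := \pi_(Quotient.quot rat_int_pred) q.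

Lemma rmi_piMz q d : rmi_pi q *~ d = rmi_pi (q *~ d).
Proof. by rewrite /rmi_pi raddfMz. Qed.

Lemma rmi_pi_eq0 q : (rmi_pi q == 0) = (q \is a Num.int).
Proof.
rewrite -[0](raddf0 (\pi_(Quotient.quot rat_int_pred))) /rmi_pi.
by rewrite -[LHS]Quotient.idealrBE subr0.
Qed.

Lemma rat_mod_int_div (d : int) (q : rat_mod_int) :
  d != 0 -> exists q', q' *~ d = q.
Proof.
move=> d0; exists (rmi_pi (repr q / d%:~R)).
rewrite rmi_piMz -mulrzr divfK ?intr_eq0 //.
exact: reprK.
Qed.

Lemma rat_mod_int_torsion (d : int) : `|d|%N != 1%N ->
  exists2 q : rat_mod_int, q *~ d = 0 & q != 0.
Proof.
have [-> _|d0 d1] := eqVneq d 0.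
  exists (rmi_pi (1 / 2%:~R)); first by rewrite mulr0z.
  by rewrite rmi_pi_eq0.
exists (rmi_pi d%:~R^-1).
  apply/eqP; rewrite rmi_piMz -mulrzr mulVf ?intr_eq0 //.
  by rewrite rmi_pi_eq0 rpred1.
rewrite rmi_pi_eq0; apply: contra d1 => /intrP[n dn].
have : (n * d == 1)%R.
  by rewrite -(eqr_int rat) rmorphM /= -dn mulVf ?intr_eq0.
move=> /eqP/(congr1 absz); rewrite abszM => /eqP; rewrite muln_eq1.
by case/andP.
Qed.

Lemma int_subgroup_principal (D : int -> Prop) :
    D 0 -> (forall m n, D m -> D n -> D (m - n)) ->
  exists d : int, forall n, D n <-> (d %| n)%Z.
Proof.
move=> D0 DB; have DN n : D n -> D (- n) by rewrite -sub0r; apply: DB.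
have DD m n : D m -> D n -> D (m + n).
  by move=> Dm /DN; rewrite -[m + n]/(m + n) -{2}[n]opprK; apply: DB.
have DMn n (k : nat) : D n -> D (n *+ k).
  by move=> Dn; elim: k => [//|k IH]; rewrite mulrS; apply: DD.
have DM n (k : int) : D n -> D (n * k).
  move=> Dn; case: k => k; first by rewrite -mulrzz; apply: DMn.
  by rewrite NegzE mulrN; apply: DN; rewrite -mulrzz; apply: DMn.
have [exk|nok] := pselect (exists k : nat, `[< D k.+1%:Z >]); last first.
  exists 0 => n; rewrite dvd0z; split=> [Dn|/eqP-> //].
  case: n Dn => [[//|k]|k] Dn; case: nok; exists k; apply/asboolP => //.
  by move: Dn => /DN; rewrite NegzE opprK.
have [k /asboolP Dk kmin] := ex_minnP exk.
exists k.+1%:Z => n; split=> [Dn|/dvdzP[c ->]]; last first.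
  by rewrite mulrC; apply: DM.
apply/dvdz_mod0P.
have : D (n %% k.+1%:Z)%Z.
  have -> : (n %% k.+1%:Z)%Z = n - k.+1%:Z * (n %/ k.+1%:Z)%Z.
    by rewrite {2}(divz_eq n k.+1) mulrC addrAC subrr add0r.
  by apply: DB => //; apply: DM.
have := @ltz_pmod n k.+1%:Z isT; have := @modz_ge0 n k.+1%:Z isT.
case: (n %% k.+1%:Z)%Z => [[//|j]|//] _ jk Dj.
by have := kmin j; move=> /(_ (asboolT Dj)); rewrite leqNgt -ltnS -ltz_nat jk.
Qed.

Section Characters.
Variable B : zmodType.
Implicit Type G : set (B * rat_mod_int).

Let graph G := [/\ G 0, forall x y, G x -> G y -> G (x - y) &
  forall q, G (0, q) -> q = 0].

Lemma char_ext G0 : graph G0 ->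
  exists chi : B -> rat_mod_int,
    {morph chi : x y / x + y} /\ forall x, G0 x -> chi x.1 = x.2.
Proof.
move=> /Zorn_above[|G [[G_0 GB Gfun] G0G maxG]].
  move=> F [X0 FX0] Fgr totF; split.
  - by exists X0 => //; case: (Fgr _ FX0).
  - move=> x y xF yF; have [X [FX Xx Xy]] := total_on_pair totF xF yF.
    by exists X => //; have [_ + _] := Fgr _ FX; apply.
  - by move=> q [X FX Xq]; have [_ _] := Fgr _ FX; apply.
have GN x : G x -> G (- x) by rewrite -sub0r; apply: GB.
have GD x y : G x -> G y -> G (x + y).
  by move=> Gx /GN Gy; rewrite -[y]opprK; apply: GB.
have GMn x (n : nat) : G x -> G (x *+ n).
  by move=> Gx; elim: n => [//|n IH]; rewrite mulrS; apply: GD.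
have GMz x (n : int) : G x -> G (x *~ n).
  move=> Gx; case: n => n; first exact: GMn.
  by rewrite NegzE mulrNz; apply/GN/GMn.
have pairMz (x : B) (q : rat_mod_int) (n : int) :
  (x, q) *~ n = (x *~ n, q *~ n).
  have fM : (x, q) *~ n = (((x, q) *~ n).1, ((x, q) *~ n).2).
    by case: (_ *~ n).
  by rewrite fM !raddfMz.
have Gtot b : exists q, G (b, q).
  have [||d dP] := @int_subgroup_principal (fun n => exists q, G (b *~ n, q)).
  - by exists 0; rewrite mulr0z.
  - by move=> m n [q Gq] [q' Gq']; exists (q - q'); rewrite mulrzBr; apply: (GB _ _ Gq Gq').
  have [q Gq] : exists q, G (b *~ d, q *~ d).
    have [t Gt] := (dP d).2 (dvdzz d).
    have [d0|/rat_mod_int_div] := eqVneq d 0; last first.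
      by move=> /(_ t)[q qd]; exists q; rewrite qd.
    exists 0; rewrite mul0rz; move: Gt; rewrite d0 mulr0z => Gt.
    by move: (Gt); rewrite (Gfun _ Gt).
  exists q; apply: (maxG [set x | exists n : int, G (x - (b, q) *~ n)]).
  - split=> [|x y [m Gm] [n Gn]|t [n]].
    + by exists 0; rewrite mulr0z subr0.
    + exists (m - n); have := GB _ _ Gm Gn.
      by rewrite mulrzBr !opprD !opprK addrACA.
    + rewrite pairMz -[_ - _]/(0 - b *~ n, t - q *~ n) sub0r => Gn.
      have /dvdzP[k nk] : (d %| n)%Z.
        apply/dP; exists (- (t - q *~ n)).
        by have := GN _ Gn; rewrite -[- (_, _)]/(- - (b *~ n), _) opprK.
      have Gbq : G (b *~ n, q *~ n).
        by have := GMz _ k Gq; rewrite pairMz nk -!mulrzA mulrC.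
      have := GD _ _ Gn Gbq; rewrite -[_ + _]/(_ + _, _ + _) /=.
      by rewrite addNr addrNK => /Gfun.
  - by move=> x Gx; exists 0; rewrite mulr0z subr0.
  - by exists 1; rewrite subrr.
have /choice[chi chiP] := Gtot.
have Guniq b q q' : G (b, q) -> G (b, q') -> q = q'.
  move=> Gq Gq'; apply/eqP; rewrite -subr_eq0; apply/eqP/Gfun.
  by have := GB _ _ Gq Gq'; rewrite -[_ - _]/(b - b, q - q') subrr.
exists chi; split=> [x y|[b q] /G0G Gq /=]; last exact: Guniq (chiP b) Gq.
exact: Guniq (chiP (x + y)) (GD _ _ (chiP x) (chiP y)).
Qed.

Lemma char_separates (m : B) : m != 0 ->
  exists2 chi : B -> rat_mod_int, {morph chi : x y / x + y} & chi m != 0.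
Proof.
move=> m0; have [||d dP] := @int_subgroup_principal (fun n => m *~ n = 0).
- by rewrite mulr0z.
- by move=> i j mi mj; rewrite mulrzBr mi mj subrr.
have [|q qd q0] := @rat_mod_int_torsion d.
  apply: contra m0 => d1; apply/eqP; rewrite -[m]mulr1z; apply/dP.
  by rewrite -dvdz1 in d1.
have [|chi [chiD chiG]] := @char_ext [set x | exists n : int, x = (m *~ n, q *~ n)].
  split; first by exists 0; rewrite !mulr0z.
    by move=> _ _ [i ->] [j ->]; exists (i - j); rewrite !mulrzBr.
  move=> t [n [mn ->]]; have /dvdzP[k ->] : (d %| n)%Z by apply/dP.
  by rewrite mulrC mulrzA qd mul0rz.
exists chi => //; have := chiG (m, q); rewrite /= => -> //.
by exists 1; rewrite !mulr1z.
Qed.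
End Characters.

Section LinearOf.
Variables (S : pzRingType) (A B : lmodType S) (f : A -> B).
Hypothesis f_lin : linear f.

Definition linear_fun_of (_ : linear f) := f.

HB.instance Definition _ :=
  GRing.isLinear.Build S A B _ (linear_fun_of f_lin) f_lin.

Lemma linear_of : exists g : {linear A -> B}, g =1 f.
Proof. by exists (linear_fun_of f_lin : {linear A -> B}). Qed.
End LinearOf.

Section SubmoduleType.
Variables (S : pzRingType) (V : lmodType S) (N : submodClosed V).

Record submod_type := SubmodType {
  submod_val : V;
  submod_valP : submod_pred N submod_val }.

HB.instance Definition _ := [isSub for submod_val].
HB.instance Definition _ := [Choice of submod_type by <:].
HB.instance Definition _ :=
  GRing.SubChoice_isSubLmodule.Build S V (submod_pred N) submod_type
    (submodClosedP N).

Lemma submod_val_lin a (x y : submod_type) :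
  val (a *: x + y) = a *: val x + val y.
Proof. exact: linearP. Qed.

Lemma submod_val0 : val (0 : submod_type) = 0.
Proof. exact: raddf0. Qed.
End SubmoduleType.

Section SetSubmodule.
Variables (S : pzRingType) (V : lmodType S) (X : set V).

Definition set_submod : Prop :=
  X 0 /\ forall (a : S) x y, X x -> X y -> X (a *: x + y).

Hypothesis X_sub : set_submod.

Definition set_submod_pred (_ : set_submod) : {pred V} := [pred x | `[< X x >]].

Lemma set_submod_pred_closed : submod_closed (set_submod_pred X_sub).
Proof.
have [X0 XD] := X_sub; split=> [|a x y]; first exact: (asboolT X0).
by move=> /asboolP Xx /asboolP Xy; apply: (asboolT (XD _ _ _ Xx Xy)).
Qed.

HB.instance Definition _ := GRing.isSubmodClosed.Build S V
  (set_submod_pred X_sub) set_submod_pred_closed.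

Lemma set_submodW : exists N : submodClosed V, forall x, x \in N <-> X x.
Proof.
exists (set_submod_pred X_sub : submodClosed V) => x.
by split=> [/asboolP|Xx]; last exact: (asboolT Xx).
Qed.
End SetSubmodule.

Lemma set_submod_bigcup (S : pzRingType) (V : lmodType S) (F : set (set V)) :
    F !=set0 -> (forall X, F X -> set_submod X) -> total_on F subset ->
  set_submod (\bigcup_(X in F) X).
Proof.
move=> [X0 FX0] Fsub totF; split; first by exists X0 => //; case: (Fsub _ FX0).
move=> a x y xF yF; have [X [FX Xx Xy]] := total_on_pair totF xF yF.
by exists X => //; have [_] := Fsub _ FX; apply.
Qed.

Section Coinduced.
Variables (S : pzRingType) (T : Type).

Definition coind_pred : {pred T -> S -> rat_mod_int} :=
  [pred f : T -> S -> rat_mod_int | `[< forall x, {morph f x : r s / r + s} >]].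

Lemma coind_pred_zmod_closed : zmod_closed coind_pred.
Proof.
split=> [|f g /asboolP fD /asboolP gD]; apply: asboolT => x r s.
  by rewrite [RHS]addr0.
by rewrite [LHS]/(f x (r + s) - g x (r + s)) fD gD opprD addrACA.
Qed.

Record coind := Coind { coind_val : T -> S -> rat_mod_int;
                        coind_valP : coind_pred coind_val }.

HB.instance Definition _ := [isSub for coind_val].
HB.instance Definition _ := [Choice of coind by <:].
HB.instance Definition _ := GRing.SubChoice_isSubZmodule.Build
  (T -> S -> rat_mod_int) coind_pred coind coind_pred_zmod_closed.

Lemma coindD (f : coind) x r s :
  coind_val f x (r + s) = coind_val f x r + coind_val f x s.
Proof. by case: f => f fP; apply: (asboolW fP). Qed.

Lemma coind_ext (f g : coind) :
  (forall x r, coind_val f x r = coind_val g x r) -> f = g.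
Proof. by move=> fg; apply: val_inj; apply/funext => x; apply/funext. Qed.

Lemma coind_mk (f : T -> S -> rat_mod_int) :
  (forall x, {morph f x : r s / r + s}) ->
  exists g : coind, coind_val g = f.
Proof. by move=> /asboolT fD; exists (@Coind f fD). Qed.

Lemma coind_scale_subproof (a : S) (f : coind) :
  coind_pred (fun x r => coind_val f x (r * a)).
Proof. by apply: asboolT => x r s; rewrite mulrDl coindD. Qed.

Definition coind_scale a f := Coind (coind_scale_subproof a f).

Lemma coind_scaleA a b f :
  coind_scale a (coind_scale b f) = coind_scale (a * b) f.
Proof. by apply: coind_ext => x r /=; rewrite mulrA. Qed.

Lemma coind_scale1 : left_id 1 coind_scale.
Proof. by move=> f; apply: coind_ext => x r /=; rewrite mulr1. Qed.

Lemma coind_scaleDr : right_distributive coind_scale +%R.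
Proof. by move=> a f g; apply: coind_ext. Qed.

Lemma coind_scaleDl f : {morph coind_scale^~ f : a b / a + b}.
Proof. by move=> a b; apply: coind_ext => x r /=; rewrite mulrDr coindD. Qed.

HB.instance Definition _ := GRing.Zmodule_isLmodule.Build S coind
  coind_scaleA coind_scale1 coind_scaleDr coind_scaleDl.

Lemma coind_valZD (a : S) (f g : coind) x r :
  coind_val (a *: f + g) x r = coind_val f x (r * a) + coind_val g x r.
Proof. by []. Qed.

Lemma coind_injective : injective_module coind.
Proof.
move=> A B i f i_inj.
have chiP x : exists chi : B -> rat_mod_int,
    {morph chi : b c / b + c} /\ forall a, chi (i a) = coind_val (f a) x 1.
  have [|chi [chiD chiE]] :=
    @char_ext B [set z | exists a, z = (i a, coind_val (f a) x 1)].
    split; first by exists 0; rewrite !linear0.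
      by move=> _ _ [a ->] [a' ->]; exists (a - a'); rewrite !linearB.
    move=> q [a [ia0 ->]]; have -> : a = 0 by apply: i_inj; rewrite linear0.
    by rewrite linear0.
  by exists chi; split=> // a; apply: (chiE (i a, _)); exists a.
have [chi {}chiP] := choice chiP.
have gP b : exists w : coind,
    forall x r, coind_val w x r = chi x (r *: b).
  have [|w wE] := @coind_mk (fun x r => chi x (r *: b)).
    by move=> x r s; rewrite scalerDl (chiP x).1.
  by exists w; rewrite wE.
have [g0 g0E] := choice gP.
have [|g gE] := @linear_of S B coind g0.
  move=> a b c; apply: coind_ext => x r.
  by rewrite coind_valZD !g0E scalerDr (chiP x).1 scalerA.
exists g => a; apply: coind_ext => x r.
by rewrite gE g0E -linearZ (chiP x).2 linearZ /= mul1r.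
Qed.
End Coinduced.

Lemma injective_embedding (S : pzRingType) (M : lmodType S) :
  exists (W : lmodType S) (i : {linear M -> W}),
    injective i /\ injective_module W.
Proof.
pose T := {chi : M -> rat_mod_int | {morph chi : x y / x + y}}.
have jP m : exists w : coind S T,
    forall x r, coind_val w x r = sval x (r *: m).
  have [|w wE] := @coind_mk S T (fun x r => sval x (r *: m)).
    by move=> [x xD] r s /=; rewrite scalerDl xD.
  by exists w; rewrite wE.
have [j0 j0E] := choice jP.
have [|j jE] := @linear_of S M (coind S T) j0.
  move=> a b c; apply: coind_ext => x r.
  by rewrite coind_valZD !j0E scalerDr (svalP x) scalerA.
exists (coind S T), j; split; last exact: coind_injective.
apply: raddf_inj => m jm0; apply/eqP; apply: contraT => /char_separates[chi chiD].
move=> /eqP[]; have := j0E m (exist _ chi chiD) 1.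
by rewrite scale1r /= -jE jm0.
Qed.

Section Hull.
Variables (S : pzRingType) (M W : lmodType S) (i : {linear M -> W}).
Hypotheses (i_inj : injective i) (W_inj : injective_module W).

Let ess (X : set W) := [/\ set_submod X, range i `<=` X &
  forall x, X x -> x != 0 -> exists a m, a *: x = i m /\ i m != 0].

Lemma injective_hull_sub :
  exists (E : lmodType S) (j : {linear M -> E}), is_injective_hull j.
Proof.
have [||E [[E_sub iE E_ess] _ E_max]] := @Zorn_above W ess (range i).
- split=> // [|_ [m _ <-] im0]; last by exists 1, m; rewrite scale1r.
  split; first by exists 0; rewrite ?linear0.
  by move=> a _ _ [x _ <-] [y _ <-]; exists (a *: x + y); rewrite ?linearP.
- move=> F F0 Fess totF; split.
  + by apply: set_submod_bigcup => // X /Fess[].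
  + have [X FX] := F0; have [_ iX _] := Fess _ FX.
    by move=> x /iX Xx; exists X.
  + by move=> x [X /Fess[_ _ + ] Xx]; apply.
have [|//|K [[K_sub KE] _ K_max]] := @Zorn_above W
  [set X | set_submod X /\ forall x, X x -> E x -> x = 0] [set 0].
- by split=> [|x ->//]; split=> // a _ _ -> ->; rewrite scaler0 addr0.
- move=> F F0 FK totF; split.
    by apply: set_submod_bigcup => // X /FK[].
  by move=> x [X /FK[_ +] Xx]; apply.
have [E' E'P] := set_submodW E_sub; have [K' K'P] := set_submodW K_sub.
have [E_0 E_D] := E_sub; have [K_0 K_D] := K_sub.
pose Et : lmodType S := submod_type E'; pose Kt : lmodType S := submod_type K'.
have EtP (e : Et) : E (val e) by apply/E'P; exact: (valP e).
have KtP (k : Kt) : K (val k) by apply/K'P; exact: (valP k).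
have [|sumEK sumEKE] := @linear_of S (Et * Kt)%type W
    (fun z => val z.1 + val z.2).
  move=> a [e k] [e' k'].
  rewrite [LHS]/(val (a *: e + e') + val (a *: k + k')) !submod_val_lin.
  by rewrite scalerDr addrACA.
have [|prE prEE] := @linear_of S (Et * Kt)%type W (fun z => val z.1).
  by move=> a [e k] [e' k']; apply: submod_val_lin.
have [|phi phiE] := @W_inj _ _ sumEK prE.
  apply: raddf_inj => -[e k] /(etrans (esym (sumEKE _)))/= ek0.
  have ek : val k = - val e by apply/eqP; rewrite -addr_eq0 addrC ek0.
  have k0 : val k = 0.
    apply: KE => //; rewrite ek -[- _]addr0 -scaleN1r; exact: E_D.
  have e0 : val e = 0 by apply/eqP; rewrite -oppr_eq0 -ek k0.
  by congr (_, _); apply: val_inj; rewrite ?e0 ?k0 linear0.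
have phi_id x : E x -> phi x = x.
  move=> /E'P Ex; pose z : (Et * Kt)%type := (SubmodType Ex, 0).
  have zx : sumEK z = x.
    apply: etrans (sumEKE z) _; rewrite -[RHS]addr0.
    exact: congr1 (submod_val0 K').
  by rewrite -[in LHS]zx; apply: etrans (phiE z) (prEE z).
have phi_K x : K x -> phi x = 0.
  move=> /K'P Kx; pose z : (Et * Kt)%type := (0, SubmodType Kx).
  have zx : sumEK z = x.
    apply: etrans (sumEKE z) _; rewrite -[RHS]add0r.
    exact: (congr1 (+%R^~ x) (submod_val0 E')).
  rewrite -[in LHS]zx; apply: etrans (phiE z) _.
  exact: etrans (prEE z) (submod_val0 E').
have kerK x : phi x = 0 -> K x.
  apply: (K_max [set x | phi x = 0]) => //; split; last first.
    by move=> y /= + /phi_id => ->.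
  by split=> [|a y z /= y0 z0]; rewrite /= ?linear0 // linearP y0 z0 scaler0 addr0.
have phiW x : E (phi x).
  apply: (E_max (range phi)); last by exists x.
    split.
    - split; first by exists 0; rewrite ?linear0.
      by move=> a _ _ [y _ <-] [z _ <-]; exists (a *: y + z); rewrite ?linearP.
    - by move=> _ [m _ <-]; exists (i m) => //; apply/phi_id/iE; exists m.
    - move=> _ [y _ <-] py0.
      pose L := [set z | exists k a, K k /\ z = k + a *: y].
      have [a [k [Kk Eaky aky0]]] :
          exists a k, [/\ K k, E (k + a *: y) & k + a *: y != 0].
        apply: contrapT => nak; move/eqP: py0; apply; apply: phi_K.
        apply: (K_max L); last by exists 0, 1; rewrite scale1r add0r.
          split; first split.
          + by exists 0, 0; rewrite scale0r addr0.
          + move=> c _ _ [k [a [Kk ->]]] [k' [a' [Kk' ->]]].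
            exists (c *: k + k'), (c * a + a'); split; first exact: K_D.
            by rewrite scalerDr scalerDl scalerA addrACA.
          + move=> z [k [a [Kk ->]]] Ez; apply/eqP; apply: contraT => z0.
            by case: nak; exists a, k.
        by move=> k Kk; exists k, 0; rewrite scale0r addr0.
      have [c [m [cm im0]]] := E_ess _ Eaky aky0.
      exists (c * a), m; split=> //.
      have Eim : E (i m) by apply: iE; exists m.
      rewrite -(phi_id _ Eim) -cm scalerDr linearD scalerA !linearZ /=.
      by rewrite (phi_K k) // scaler0 add0r.
  by move=> z Ez; exists z => //; apply: phi_id.
have /choice[j0 j0E] m : exists e : Et, val e = i m.
  have /E'P Eim : E (i m) by apply: iE; exists m.
  by exists (SubmodType Eim).
have [|j jE] := @linear_of S M Et j0.
  by move=> a x y; apply: val_inj; rewrite submod_val_lin !j0E linearP.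
exists Et, j; split.
- by move=> x y; rewrite !jE => /(congr1 val); rewrite !j0E => /i_inj.
- move=> N [x Nx x0].
  have [|a [m [axm im0]]] := E_ess (val x) (EtP x).
    by apply: contra x0 => /eqP x0; apply/eqP/val_inj; rewrite x0 linear0.
  exists m; last first.
    apply: contra im0 => /eqP/(congr1 val); rewrite jE j0E linear0 => ->.
    by [].
  have -> : j m = a *: x by apply: val_inj; rewrite jE j0E linearZ.
  exact: rpredZ.
- move=> A B h f h_inj.
  have [|fW fWE] := @linear_of S A W (val \o f).
    by move=> a x y; rewrite linearP; apply: submod_val_lin.
  have [gW gWE] := @W_inj _ _ h fW h_inj.
  have /choice[g0 g0E] b : exists e : Et, val e = phi (gW b).
    have /E'P Eb := phiW (gW b).
    by exists (SubmodType Eb).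
  have [|g gE] := @linear_of S B Et g0.
    by move=> a x y; apply: val_inj; rewrite submod_val_lin !g0E !linearP.
  exists g => a; apply: val_inj.
  by rewrite gE g0E gWE fWE phi_id //; apply: EtP.
Qed.
End Hull.

Lemma injective_hull_exists (S : pzRingType) (M : lmodType S) :
  exists (E : lmodType S) (j : {linear M -> E}), is_injective_hull j.
Proof.
have [W [i [i_inj W_inj]]] := injective_embedding M.
exact: injective_hull_sub i_inj W_inj.
Qed.

Definition injective_hull (S : pzRingType) (M : lmodType S) : lmodType S :=
  sval (cid (injective_hull_exists M)).

Lemma injective_hullP (S : pzRingType) (M : lmodType S) :
  exists j : {linear M -> injective_hull M}, is_injective_hull j.
Proof. exact: svalP (cid (injective_hull_exists M)). Qed.

Section Monoform.
Variables (R : pzRingType) (M : rmodType R).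

(* The set x (y^-1 N) contains a nonzero element. *)
Definition dense (N : submodClosed M) : Prop :=
  forall x y : M, x != 0 -> exists2 r : R^c, r \in residual y N & r *: x != 0.

Definition monoform : Prop :=
  (exists x : M, x != 0) /\
  forall N : submodClosed M, nonzero_submod N -> dense N.
End Monoform.

Section RightIdeals.
Variable R : pzRingType.
Implicit Types (I J P : right_ideal R) (F : set (right_ideal R)).

Definition proper_right_ideal P : Prop := exists r : R^c^o, r \notin P.

Definition gabriel_filter F : Prop :=
  [/\ F !=set0,
      forall I J, F I -> {subset I <= J} -> F J,
      forall I J, F I -> F J -> F (capS I J),
      forall I (x : R^c^o), F I -> F (residual x I) &
      forall I J, F I -> (forall x : R^c^o, x \in I -> F (residual x J)) -> F J].

Definition Max F : set (right_ideal R) :=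
  [set P | F P /\ forall J, F J -> {subset P <= J} -> {subset J <= P}].

Definition comonoform P : Prop :=
  proper_right_ideal P /\ monoform (quotmod P : rmodType R).

(* The right ideals J such that Hom_R(R/J, E(R/P)) = 0. *)
Definition hull_filter P : set (right_ideal R) :=
  [set J | forall f : {linear quotmod J -> injective_hull (quotmod P)},
             forall x, f x = 0].
End RightIdeals.

(* Main.v *)
Require Import Defs.
From HB Require Import structures.
From mathcomp Require Import all_boot all_order all_algebra.
From mathcomp Require Import boolp classical_sets functions.

Set Implicit Arguments.
Unset Strict Implicit.
Unset Printing Implicit Defensive.

Import Order.TTheory GRing.Theory Num.Theory.
Local Open Scope ring_scope.
Local Open Scope classical_set_scope.

(** Everything rests on an elementary description of the Gabriel filter
    cogenerated by an injective hull.  For a right module M, let F(M) be the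
    family of the right ideals J such that x (y^-1 J) != 0 for all y in R and
    all nonzero x in M.

    F(M) consists of the J with Hom(R/J, E(M)) = 0 ([cogenerated_hullP]).  A
    homomorphism R/J -> E(M) amounts to an element e of E(M) killed by J.  If
    e != 0, then essentiality gives r such that e r is a nonzero element x of
    M, and x (r^-1 J) = 0.  Conversely, if x (y^-1 J) = 0, then
    y r + J |-> x r is well defined on (y R + J)/J and extends to R/J because
    E(M) is injective.  In this form the axioms of a Gabriel filter are direct
    computations ([cogenerated_gabriel]).  Hence a right ideal maximal outside
    the filter cogenerated by E(R/P) is maximal outside some Gabriel filter.

    Suppose that R/P is monoform.  If J strictly contains P, then the density
    of J/P in R/P says that J lies in F(R/P), whereas P does not: the coset of
    1 is killed by P.  So P is maximal outside F(R/P) ([comonoform_Max]).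

    Suppose finally that P is maximal outside a Gabriel filter F
    ([Max_comonoform]).  The preimage J of a nonzero submodule of R/P lies in
    F, hence so does y^-1 J for every y.  If that submodule were not dense,
    some a outside P would satisfy y^-1 J <= a^-1 P for some y, which puts
    a^-1 P in F.  Then k^-1 P lies in F for every k in a R + P, and a R + P
    lies in F because it strictly contains P; so P lies in F, a
    contradiction. *)

(** * Linear maps and submodules *)

Section LinearMaps.
Variables (S : pzRingType) (V W : lmodType S).

Lemma quotmod_lift (N : submodClosed V) (f : {linear V -> W}) :
    (forall x, x \in N -> f x = 0) ->
  exists g : {linear quotmod N -> W}, forall x, g (quotmod_pi N x) = f x.
Proof.
move=> fN0; pose g0 (z : quotmod N) := f (repr z).
have g0E x : g0 (quotmod_pi N x) = f x.
  apply/eqP; rewrite -subr_eq0 -linearB; apply/eqP/fN0.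
  by rewrite -quotmod_piP quotmod_reprK.
have [|g gE] := @linear_of S (quotmod N) W g0; last first.
  by exists g => x; rewrite gE.
move=> a y z; rewrite -[y]quotmod_reprK -[z]quotmod_reprK -linearP.
by rewrite !g0E linearP.
Qed.

Lemma preim_submod (f : {linear V -> W}) (N : submodClosed W) :
  exists K : submodClosed V, forall x, (x \in K) = (f x \in N).
Proof.
have [|K KP] := @set_submodW S V [set x | f x \in N].
  split=> [|a x y /= fx fy] /=; first by rewrite linear0 rpred0.
  by rewrite linearP rpredD // rpredZ.
by exists K => x; apply/idP/idP => /KP.
Qed.

Lemma image_submod (f : {linear V -> W}) (K : submodClosed V) :
  exists N : submodClosed W, forall z, z \in N <-> exists2 x, x \in K & f x = z.
Proof.
apply: (@set_submodW S W [set z | exists2 x, x \in K & f x = z]).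
split=> [|a _ _ [x Kx <-] [y Ky <-]].
  by exists 0; rewrite ?rpred0 ?linear0.
by exists (a *: x + y); rewrite ?linearP // rpredD // rpredZ.
Qed.

Lemma add_cyclic_submod (N : submodClosed V) (x : V) :
  exists L : submodClosed V,
    forall z, z \in L <-> exists a : S, z - a *: x \in N.
Proof.
apply: (@set_submodW S V [set z | exists a : S, z - a *: x \in N]).
split=> [|c y z [a Na] [b Nb]]; first by exists 0; rewrite scale0r subrr rpred0.
exists (c * a + b); rewrite scalerDl -scalerA opprD addrACA -scalerBr.
by rewrite rpredD // rpredZ.
Qed.

End LinearMaps.

(** With [quotmod_lift], this makes an element of V killed by an ideal J into a
    linear map from S/J to V. *)
Lemma scale_linear (S : pzRingType) (V : lmodType S) (m : V) :
  exists f : {linear S^o -> V}, forall r : S, f r = r *: m.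
Proof.
apply: (@linear_of S S^o V (fun r : S^o => (r : S) *: m)).
by move=> a x y; rewrite scalerDl scalerA.
Qed.

Lemma quotmod_pi_eq0 (S : pzRingType) (V : lmodType S) (N : submodClosed V) x :
  (quotmod_pi N x == 0) = (x \in N).
Proof. by rewrite -(linear0 (quotmod_pi N)) quotmod_piP subr0. Qed.

Lemma quotmod_submod (S : pzRingType) (V : lmodType S) (N K : submodClosed V) :
    {subset N <= K} ->
  exists L : submodClosed (quotmod N),
    forall x, (quotmod_pi N x \in L) = (x \in K).
Proof.
move=> sNK; have [L LP] := image_submod (quotmod_pi N) K; exists L => x.
apply/idP/idP => [/LP[y Ky /esym/eqP]|Kx]; last by apply/LP; exists x.
by rewrite quotmod_piP => /sNK xyK; rewrite -[x](subrK y) rpredD.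
Qed.

(** * The family cogenerated by a module *)

(** The torsion filter of the hereditary torsion theory cogenerated by E(M),
    written without E(M); the two descriptions agree by [cogenerated_hullP].
    For S the converse ring of R, this is the family F(M) of right ideals. *)
Definition cogenerated (S : pzRingType) (M : lmodType S) :
    set (submodClosed S^o) :=
  [set J | forall (x : M) (y : S^o), x != 0 ->
             exists2 r : S, r \in residual y J & r *: x != 0].

Section CogeneratedHull.
Variables (S : pzRingType) (M E : lmodType S) (j : {linear M -> E}).
Hypothesis hull_j : is_injective_hull j.

(** Essentiality of M in E turns a nonzero map S/J -> E into a pair x, y
    violating the condition on J; injectivity of E turns such a pair into a
    nonzero map. *)
Lemma cogenerated_hullP (J : submodClosed S^o) :
  cogenerated M J <-> forall (f : {linear quotmod J -> E}) x, f x = 0.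
Proof.
have [j_inj j_ess E_inj] := hull_j.
split=> [JM f z|JE x y x0].
  apply/eqP; apply: contraT => fz0.
  (* N is the cyclic submodule generated by f z: the residual of 0 is S *)
  have [h hE] := scale_linear (f z).
  have [N NP] := image_submod h (residual (0 : S^o) J).
  have Kall r : r \in residual (0 : S^o) J by rewrite inE scaler0 rpred0.
  have [|m /NP[r _ rm] jm0] := j_ess N.
    by exists (f z) => //; apply/NP; exists 1 => //; rewrite hE scale1r.
  have m0 : m != 0 by apply: contra jm0 => /eqP->; rewrite linear0.
  (* j m = r (f z), so any s with s r z = 0 in S/J satisfies s m = 0 *)
  have [s] := JM m (r *: (repr z : S^o)) m0.
  rewrite inE => sJ /eqP[]; apply: j_inj; rewrite linear0 linearZ -rm hE /=.
  have -> : s *: ((r : S) *: f z) =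
      f (quotmod_pi J (s *: ((r : S) *: (repr z : S^o)))).
    (* scaling a coset is by definition scaling its representative *)
    by rewrite !linearZ.
  by rewrite (eqP (_ : quotmod_pi J _ == 0)) ?linear0 // quotmod_pi_eq0.
apply: contrapT => nr.
have kill (r : S) : r \in residual y J -> r *: x = 0.
  by move=> ry; apply/eqP; apply: contraT => rx0; case: nr; exists r.
(* the quotient by the residual of y embeds in S/J by r |-> r y, and maps to
   E by r |-> r x; i and f are these two maps *)
have [u uE] := scale_linear (quotmod_pi J y).
have [v vE] := scale_linear (j x).
have uJ (r : S) : (u r == 0) = (r \in residual y J).
  by rewrite uE -linearZ quotmod_pi_eq0 inE.
have [|i iE] := @quotmod_lift S S^o _ (residual y J) u.
  by move=> r; rewrite -uJ => /eqP.
have [|f fE] := @quotmod_lift S S^o _ (residual y J) v.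
  by move=> r /kill rx0; rewrite vE -linearZ rx0 linear0.
have i_ker z : i z = 0 -> z = 0.
  rewrite -(quotmod_reprK z) iE => /eqP; rewrite uJ => zJ.
  by apply/eqP; rewrite quotmod_pi_eq0.
have [|g gE] := E_inj _ _ i f; first exact: raddf_inj i_ker.
case/eqP: x0; apply: j_inj; rewrite linear0 -[j x]scale1r -vE -fE -gE.
exact: JE.
Qed.

End CogeneratedHull.

(** * Gabriel filters and comonoform right ideals *)

Section GabrielFilters.
Variable R : pzRingType.
Implicit Types I J P : right_ideal R.

(** Closure under intersection and under the transitivity axiom both hold
    because two multipliers can be found in succession: the second one is
    applied to the nonzero element x r produced by the first. *)
Lemma cogenerated_gabriel (M : rmodType R) :
  gabriel_filter (cogenerated M : set (right_ideal R)).
Proof.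
have [T TP] : exists T : right_ideal R, forall x, x \in T <-> True.
  exact: (@set_submodW R^c R^c^o setT).
split.
- exists T => x y x0; exists 1; last by rewrite scale1r.
  by rewrite inE; apply/TP.
- move=> I J IM sIJ x y x0; have [r ry rx0] := IM x y x0.
  by exists r => //; rewrite inE; apply: sIJ; rewrite inE in ry.
- move=> I J IM JM x y x0; have [r rI rx0] := IM x y x0.
  have [s sJ srx0] := JM (r *: x) (r *: y) rx0.
  exists (s * r); last by rewrite -scalerA.
  rewrite !inE in rI sJ *; rewrite -scalerA; apply/andP; split=> //.
  exact: rpredZ.
- move=> I z IM x y x0; have [r rI rx0] := IM x (y *: z) x0.
  by exists r => //; rewrite !inE scalerA in rI *.
- move=> I J IM IJ x y x0; have [r rI rx0] := IM x y x0.
  rewrite inE in rI; have [s sJ srx0] := IJ _ rI (r *: x) (1 : R^c) rx0.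
  exists (s * r); last by rewrite -scalerA.
  by move: sJ; rewrite !inE -scalerA [X in X *: (r *: y)]mulr1.
Qed.

Lemma notin_cogenerated P :
  proper_right_ideal P -> ~ cogenerated (quotmod P) P.
Proof.
move=> [z zP] /(_ (quotmod_pi P (1 : R^c)) (1 : R^c)) [|r].
  rewrite quotmod_pi_eq0; apply: contra zP => P1.
  by rewrite -[z]mulr1; apply: rpredZ.
by rewrite inE -linearZ quotmod_pi_eq0 => ->.
Qed.

Lemma hull_filterE P : hull_filter P = cogenerated (quotmod P).
Proof.
have [j hull_j] := injective_hullP (quotmod P).
by apply/seteqP; split=> J /(cogenerated_hullP hull_j).
Qed.

(** The residual of y at J is the residual of its coset at J/P, so for J
    strictly above P the density of J/P is membership of J in the family. *)
Lemma comonoform_Max P : comonoform P -> Max (~` cogenerated (quotmod P)) P.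
Proof.
move=> [properP [_ dens]]; split=> [|J nJ sPJ]; first exact: notin_cogenerated.
move=> z zJ; apply: contraT => zP; case: nJ => x y x0.
have [N NJ] := quotmod_submod sPJ.
have [|r rN rx0] := dens N _ x (quotmod_pi P y) x0.
  by exists (quotmod_pi P z); rewrite ?NJ ?quotmod_pi_eq0.
by exists r => //; rewrite !inE in rN *; rewrite -NJ linearZ.
Qed.

(** A submodule of R/P that is not dense puts a^-1 P in F for some a outside P;
    the transitivity axiom, applied to a R + P, then puts P itself in F. *)
Lemma Max_comonoform P (F : set (right_ideal R)) :
  proper_right_ideal P -> gabriel_filter F -> Max (~` F) P -> comonoform P.
Proof.
move=> properP [_ FS _ FR FT] [PF maxP].
have above J z : {subset P <= J} -> z \in J -> z \notin P -> F J.
  move=> sPJ zJ zP; apply: contrapT => /maxP/(_ sPJ)/(_ _ zJ).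
  exact/negP.
split=> //; split.
  by have [z zP] := properP; exists (quotmod_pi P z); rewrite quotmod_pi_eq0.
move=> N [w Nw w0] x y x0.
have [J JP] := preim_submod (quotmod_pi P) N.
have FJ : F J.
  apply: (above J (repr w)).
  - move=> p; rewrite -quotmod_pi_eq0 => /eqP p0.
    by rewrite JP /= p0 rpred0.
  - by rewrite JP /= quotmod_reprK.
  - by rewrite -quotmod_pi_eq0 quotmod_reprK.
apply: contrapT => nr; apply: PF.
pose a : R^c^o := repr x; pose b : R^c^o := repr y.
have aP : a \notin P by rewrite -quotmod_pi_eq0 quotmod_reprK.
have Fa : F (residual a P).
  apply: (FS (residual b J)) => [|r]; first exact: FR.
  rewrite !inE JP linearZ /= quotmod_reprK => rN.
  rewrite -quotmod_pi_eq0 linearZ /= quotmod_reprK.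
  by apply: contraT => rx0; case: nr; exists r; rewrite ?inE.
(* K = a R + P, and the residual of k = a c + p at P is that of a c *)
have [K KP] := add_cyclic_submod P a.
apply: (FT K) => [|k /KP[c kc]].
  apply: (above K a) => //; last first.
    by apply/KP; exists 1; rewrite scale1r subrr rpred0.
  by move=> p pP; apply/KP; exists 0; rewrite scale0r subr0.
apply: (FS _ _ (FR _ (c : R^c^o) Fa)) => r.
rewrite !inE => rca; rewrite -[k](subrK (c *: a)) scalerDr rpredD //.
  exact: rpredZ.
by rewrite scalerA.
Qed.

End GabrielFilters.

Theorem proposition6p21 (R : pzRingType) (P : right_ideal R)
    (properP : proper_right_ideal P) :
  [<-> exists2 F : set (right_ideal R), gabriel_filter F & Max (~` F) P;
       Max (~` hull_filter P) P;
       comonoform P].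
Proof.
have imp13 : (exists2 F : set (right_ideal R), gabriel_filter F & Max (~` F) P)
    -> comonoform P by move=> [F Fgab]; apply: Max_comonoform.
have imp32 : comonoform P -> Max (~` hull_filter P) P.
  by rewrite hull_filterE; apply: comonoform_Max.
have imp21 : Max (~` hull_filter P) P ->
    exists2 F : set (right_ideal R), gabriel_filter F & Max (~` F) P.
  exists (hull_filter P) => //; rewrite hull_filterE.
  exact: (@cogenerated_gabriel R (quotmod P)).
by tfae; [move/imp13/imp32|move/imp21/imp13|move/imp32/imp21].
Qed.
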